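(* Let $S$ be the set of all cumulative distribution functions (of real-valued random variables). Regard the relative effect $\theta=\theta(F,G)$ and the overlap index $I_2=I_2(F,G)$ as functions from $S\times S$ to $[0,1]$, and accordingly consider $$(\theta,I_2):\ S\times S\longrightarrow [0,1]\times[0,1],\qquad (F,G)\longmapsto (\theta(F,G),I_2(F,G)).$$ Then the image of $(\theta,I_2)$ is exactly $$A:=\{(x,y)\ :\ x\in[0,1],\ y\in[0,\min\{2x,\,2-2x\}]\}.$$
   Context: For a cumulative distribution function $F$, the quantile function is $F^{-1}(t)=\inf\{y:F(y)\ge t\}$, $t\in(0,1)$. For cumulative distribution functions $F,G$ on $\mathbb{R}$, the relative effect (Mann-Whitney functional) is $$\theta(F,G)=\int_0^1 G\bigl(F^{-1}(\alpha)\bigr)\,d\alpha=\int G\,dF,$$ and the (asymmetric) overlap index of $G$ with respect to $F$ is $$I_2(F,G)=\int_0^1 G\bigl(F^{-1}(1-\alpha/2)\bigr)\,d\alpha-\int_0^1 G\bigl(F^{-1}(\alpha/2)\bigr)\,d\alpha .$$ *)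

(* Defs.v *)
From mathcomp Require Import all_boot all_order all_algebra.
From mathcomp Require Import all_classical all_reals all_analysis.

Set Implicit Arguments.
Unset Strict Implicit.
Unset Printing Implicit Defensive.

Import Order.TTheory GRing.Theory Num.Theory.
Import numFieldNormedType.Exports.

Local Open Scope classical_set_scope.
Local Open Scope ring_scope.

(* The library's [cdf X] takes values in the extended reals; members of [CDF]
   are its real-valued versions. *)
Definition CDF (R : realType) : set (R -> R) :=
  [set F | exists (d : measure_display) (T : measurableType d)
             (P : probability T R) (X : {RV P >-> R}),
             forall y : R, cdf X y = (F y)%:E].

(* [inf] is total on sets of reals; for a cdf F the set below is nonempty and
   bounded below when 0 < t < 1, the only case used. *)
Definition quantile (R : realType) (F : R -> R) (t : R) : R :=
  inf [set y : R | t <= F y].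

Definition relative_effect (R : realType) (F G : R -> R) : R :=
  \int[lebesgue_measure]_(a in `]0, 1[) G (quantile F a).

Definition overlap_index (R : realType) (F G : R -> R) : R :=
  \int[lebesgue_measure]_(a in `]0, 1[) G (quantile F (1 - a / 2))
  - \int[lebesgue_measure]_(a in `]0, 1[) G (quantile F (a / 2)).

(* Main.v *)
Require Import Defs.
From HB Require Import structures.
From mathcomp Require Import all_boot all_order all_algebra.
From mathcomp Require Import all_classical all_reals all_analysis.
From mathcomp Require Import measurable_realfun ring lra.

Set Implicit Arguments.
Unset Strict Implicit.
Unset Printing Implicit Defensive.

Import Order.TTheory GRing.Theory Num.Theory.
Import numFieldNormedType.Exports.

Local Open Scope classical_set_scope.
Local Open Scope ring_scope.

(** Put [h a = G (F^-1 a)], a nondecreasing function on ]0, 1[ with values in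
    [0, 1], and let [L], [U] be the integrals over ]0, 1[ of [h (a / 2)] and
    [h (1 - a / 2)], that is, the means of [h] over the lower and upper halves
    of ]0, 1[.  Then [theta = (L + U) / 2] and [I2 = U - L] with
    [0 <= L <= U <= 1], which is exactly the region [A].  Conversely, every such
    pair [L], [U] occurs when [F] is uniform on {0, 1} and [G] has mass [L] at 0,
    [U - L] at 1 and [1 - U] at 2. *)

(** * Affine substitution and the splitting of ]0, 1[ into halves *)

(** By uniqueness of Lebesgue measure, it is enough to compare both sides on half-open intervals. *)
Lemma lebesgue_measure_affine (R : realType) (c d : R) (A : set R) :
  c != 0 -> measurable A ->
  lebesgue_measure A = (`|c|%:E * lebesgue_measure
    ((fun x => (c * x + d)%R) @^-1` A))%E.
Proof.
move=> c0 mA.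
pose phi (x : measurableTypeR R) : measurableTypeR R := c * x + d.
have mphi : measurable_fun [set: measurableTypeR R] phi.
  by apply: measurable_funD => //; exact: measurable_funM.
pose mu : {measure set (measurableTypeR R) -> \bar R} :=
  mscale (NngNum (normr_ge0 c)) (pushforward lebesgue_measure phi).
suff H : forall B, ocitv B -> lebesgue_measure B = mu mphi B.
  exact: (lebesgue_measure_unique H mA).
move=> _ [[a b] _ <-].
rewrite /mu /= /mscale /= /pushforward.
have [ab|ba] := ltP a b; last first.
  by rewrite set_itv_ge ?bnd_simp -?leNgt// preimage_set0 !measure0 mule0.
case: (ltgtP c 0) c0 => // cs _.
(* A negative slope swaps the endpoints, so the closed end moves to the left. *)
- rewrite (_ : _ @^-1` _ = `[(b - d) / c, (a - d) / c[%classic); last first.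
    apply/seteqP; split=> x /=; rewrite /phi !in_itv/= ?ler_ndivrMr ?ltr_ndivlMr//;
      by move=> /andP[? ?]; apply/andP; split; lra.
  rewrite !lebesgue_measure_itv/= !lte_fin ab ltr_ndivlMr// divfK ?lt_eqF//.
  rewrite ltrD2r ab -!EFinD -EFinM ltr0_norm//; congr EFin; field.
  by rewrite lt_eqF.
- rewrite (_ : _ @^-1` _ = `](a - d) / c, (b - d) / c]%classic); last first.
    apply/seteqP; split=> x /=; rewrite /phi !in_itv/= ?ler_pdivlMr ?ltr_pdivrMr//;
      by move=> /andP[? ?]; apply/andP; split; lra.
  rewrite !lebesgue_measure_itv/= !lte_fin ab ltr_pdivlMr// divfK ?gt_eqF//.
  rewrite ltrD2r ab -!EFinD -EFinM gtr0_norm//; congr EFin; field.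
  by rewrite gt_eqF.
Qed.

Lemma Rintegral_affine (R : realType) (c d : R) (A : set R) (g : R -> R) :
  c != 0 -> measurable A -> measurable_fun A g -> (forall x, 0 <= g x) ->
  \int[lebesgue_measure]_(x in A) g x = `|c| *
  \int[lebesgue_measure]_(x in (fun x => c * x + d) @^-1` A) g (c * x + d).
Proof.
move=> c0 mA mg g0.
have mphi : measurable_fun [set: measurableTypeR R]
    (fun x => c * x + d : measurableTypeR R).
  by apply: measurable_funD => //; exact: measurable_funM.
pose phi : {mfun measurableTypeR R >-> measurableTypeR R} :=
  HB.pack (fun x : measurableTypeR R => c * x + d : measurableTypeR R)
    (isMeasurableFun.Build _ _ _ _ _ mphi).
have mEg : measurable_fun (A : set (measurableTypeR R)) (EFin \o g).
  exact/measurable_EFinP.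
rewrite /Rintegral -[`|c|]/(fine `|c|%:E).
rewrite (eq_measure_integral (mscale (NngNum (normr_ge0 c))
  (pushforward lebesgue_measure phi))); last first.
  by move=> B mB _; exact: lebesgue_measure_affine.
rewrite ge0_integral_mscale//; last by move=> y _; rewrite lee_fin.
rewrite (ge0_integral_pushforward mphi)//; last first.
  by move=> y _; rewrite lee_fin.
have : 0 < `|c| by rewrite normr_gt0.
(* For an infinite integral, [fine] returns 0 on both sides; hence no integrability of [g] is
   assumed. *)
case: integral => [r|/=|/=] c_gt0 //=.
  by rewrite gt0_muley ?lte_fin//= mulr0.
by rewrite gt0_muleNy ?lte_fin//= mulr0.
Qed.

Lemma integrable_itv01 (R : realType) (g : R -> R) (a b : R) :
  measurable_fun setT g -> (forall x, 0 <= g x <= 1) ->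
  (@lebesgue_measure R).-integrable `]a, b[ (EFin \o g).
Proof.
move=> mg g01; apply: measurable_bounded_integrable => //=.
- by rewrite lebesgue_measure_itv/=; case: ifP => _; rewrite -?EFinB ltry.
- exact: measurable_funTS.
- exists 1; split => // M M1 x _ /=; have /andP[g0 g1] := g01 x.
  by rewrite ger0_norm// (le_trans g1)// ltW.
Qed.

(** The maps [x / 2] and [1 - x / 2] carry ]0, 1[ onto its lower and upper halves, each with
    Jacobian 1/2. Monotonicity of [g] supplies its measurability. *)
Lemma Rintegral_halves (R : realType) (g : R -> R) :
  {homo g : x y / x <= y} -> (forall x, 0 <= g x <= 1) ->
  2 * \int[lebesgue_measure]_(x in `]0, 1[) g x =
  \int[lebesgue_measure]_(x in `]0, 1[) g (x / 2) +
  \int[lebesgue_measure]_(x in `]0, 1[) g (1 - x / 2).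
Proof.
move=> ndg g01.
have mg D : measurable D -> measurable_fun D g.
  by move=> mD; exact: nondecreasing_measurable.
have ig a b := integrable_itv01 a b (mg _ measurableT) g01.
have g0 x : 0 <= g x by case/andP: (g01 x).
have lower : \int[lebesgue_measure]_(x in `]0, 2^-1[) g x =
    2^-1 * \int[lebesgue_measure]_(x in `]0, 1[) g (x / 2).
  rewrite (@Rintegral_affine _ 2^-1 0)//; last exact: mg.
  rewrite ger0_norm//; congr (_ * _); rewrite (_ : _ @^-1` _ = `]0, 1[%classic).
    by apply: eq_Rintegral => x _; rewrite addr0 mulrC.
  by apply/seteqP; split=> x /=; rewrite !in_itv/= => /andP[? ?];
    apply/andP; split; lra.
have upper : \int[lebesgue_measure]_(x in `]2^-1, 1[) g x =
    2^-1 * \int[lebesgue_measure]_(x in `]0, 1[) g (1 - x / 2).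
  rewrite (@Rintegral_affine _ (- 2^-1) 1)//; last exact: mg.
  rewrite normrN ger0_norm//; congr (_ * _).
  rewrite (_ : _ @^-1` _ = `]0, 1[%classic).
    by apply: eq_Rintegral => x _; congr g; lra.
  by apply/seteqP; split=> x /=; rewrite !in_itv/= => /andP[? ?];
    apply/andP; split; lra.
have h0 : (0 : R) <= 2^-1 by lra.
have h1 : 2^-1 < (1 : R) by lra.
(* The cut leaves 1/2 in the lower piece; this null endpoint is then dropped. *)
have := @Rintegral_itvB _ g (BRight 0) (BLeft 1) 2^-1 (ig 0 1).
rewrite !bnd_simp/= -Rintegral_itv_bndo_bndc// upper lower.
by move=> /(_ h0 h1); lra.
Qed.

(** * Three-point distributions *)

(* The cdf of the mass distribution [p] at 0, [q] at 1, [1 - p - q] at 2. *)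
Lemma step_CDF (R : realType) (p q : R) : 0 <= p -> 0 <= q -> p + q <= 1 ->
  CDF (fun y => p * (0 <= y)%R%:R + q * (1 <= y)%R%:R
                + (1 - p - q) * (2 <= y)%R%:R).
Proof.
move=> p0 q0 pq1.
have r0 : 0 <= 1 - p - q by lra.
pose mu : {measure set (measurableTypeR R) -> \bar R} :=
  measure_add (mscale (NngNum p0) \d_(0 : measurableTypeR R))
    (measure_add (mscale (NngNum q0) \d_(1 : measurableTypeR R))
       (mscale (NngNum r0) \d_(2 : measurableTypeR R))).
have muE A : mu A = (p * (0%R \in A)%:R + q * (1%R \in A)%:R
                     + (1 - p - q) * (2%R \in A)%:R)%:E.
  rewrite [LHS]measure_addE [X in (_ + X)%E]measure_addE.
  by rewrite /= /mscale/= !diracE -!EFinM -!EFinD addrA.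
have mu1 : mu setT = 1%E.
  by rewrite muE !in_setT !mulr1; congr EFin; lra.
pose P : probability (measurableTypeR R) R :=
  HB.pack (Measure.sort mu)
    (Measure_isProbability.Build _ _ _ (Measure.sort mu) mu1).
have mid : measurable_fun [set: measurableTypeR R] (idfun : _ -> R).
  exact: measurable_id.
(* The identity on the line has law [mu] itself. *)
pose X : {RV P >-> R} := HB.pack (idfun : measurableTypeR R -> R)
  (isMeasurableFun.Build _ _ _ _ _ mid).
exists _, (measurableTypeR R), P, X => y.
rewrite /cdf /distribution /pushforward preimage_id -[LHS]/(mu _) muE.
by rewrite !mem_setE !in_itv.
Qed.

(** * Cdfs and their quantiles *)

Lemma CDF_nondecreasing (R : realType) (F : R -> R) :
  CDF F -> {homo F : x y / x <= y}.
Proof.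
move=> [d [T [P [X XF]]]] x y xy.
by rewrite -lee_fin -!XF; exact: cdf_nondecreasing.
Qed.

Lemma CDF_itv01 (R : realType) (F : R -> R) (y : R) : CDF F -> 0 <= F y <= 1.
Proof.
move=> [d [T [P [X XF]]]].
by rewrite -!lee_fin -XF cdf_ge0 cdf_le1.
Qed.

(** Makes the set whose infimum is [quantile F t] nonempty, because [F] tends to 1 at +oo. *)
Lemma CDF_exists_ge (R : realType) (F : R -> R) (t : R) :
  CDF F -> t < 1 -> exists y, t <= F y.
Proof.
move=> [d [T [P [X XF]]]] t1.
have F1 : F x @[x --> +oo] --> (1 : R).
  apply: (@fine_cvg _ _ _ _ (EFin \o F)).
  by rewrite (_ : EFin \o F = cdf X); [exact: cvg_cdfy1|exact/funext].
have [y ty] := filter_ex (cvgr_gt 1 F1 _ t1).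
by exists y; exact: ltW.
Qed.

(** Together with monotonicity, bounds that set from below, because [F] tends to 0 at -oo. *)
Lemma CDF_exists_lt (R : realType) (F : R -> R) (t : R) :
  CDF F -> 0 < t -> exists y, F y < t.
Proof.
move=> [d [T [P [X XF]]]] t0.
have F0 : F x @[x --> -oo] --> (0 : R).
  apply: (@fine_cvg _ _ _ _ (EFin \o F)).
  by rewrite (_ : EFin \o F = cdf X); [exact: cvg_cdfNy0|exact/funext].
have [y ty] := filter_ex (cvgr_lt 0 F0 _ t0).
by exists y.
Qed.

(** Raising the level shrinks the set under the infimum. The two existence hypotheses make the set
    at [t] nonempty and the set at [s] bounded below. *)
Lemma quantile_nondecreasing (R : realType) (F : R -> R) (s t : R) :
  (exists y, t <= F y) -> (exists m, F m < s) -> {homo F : x y / x <= y} ->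
  s <= t -> quantile F s <= quantile F t.
Proof.
move=> [y ty] [m Fms] ndF st; apply: lb_le_inf; first by exists y.
move=> z /= tz; apply: ge_inf; last exact: le_trans tz.
exists m => x /= sx; rewrite leNgt; apply/negP => xm.
have := le_lt_trans (ndF _ _ (ltW xm)) Fms.
by rewrite ltNge sx.
Qed.

(* [quantile F] is a junk value outside ]0, 1[, so [G \o quantile F] itself need
   not be monotone on the whole line. *)
Lemma CDF_quantile_extension (R : realType) (F G : R -> R) :
  CDF F -> CDF G -> exists g : R -> R,
    [/\ {homo g : x y / x <= y}, forall x, 0 <= g x <= 1 &
        forall a, 0 < a < 1 -> G (quantile F a) = g a].
Proof.
move=> cF cG.
(* The outer values 0 and 1 are bounds for [G], so gluing them on preserves monotonicity. *)
exists (fun a => if a <= 0 then 0 else if 1 <= a then 1 else G (quantile F a)).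
split.
- move=> x y xy; have [x0|x0] := leP x 0.
    case: ifP => // _; case: ifP => // _.
    by have /andP[] := CDF_itv01 (quantile F y) cG.
  rewrite (lt_geF (lt_le_trans x0 xy)); have [x1|x1] := leP 1 x.
    by rewrite (le_trans x1 xy).
  have [y1|y1] := leP 1 y.
    by have /andP[] := CDF_itv01 (quantile F x) cG.
  apply: CDF_nondecreasing => //; apply: quantile_nondecreasing => //.
  + exact: CDF_exists_ge.
  + exact: CDF_exists_lt.
  + exact: CDF_nondecreasing.
- move=> x; case: ifP => _; first by rewrite lexx ler01.
  by case: ifP => _; rewrite ?lexx ?ler01// CDF_itv01.
- by move=> a /andP[a0 a1]; rewrite !lt_geF.
Qed.

(** Here the infimum is a minimum, attained at [x]. *)
Lemma quantile_eq (R : realType) (F : R -> R) (t x : R) :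
  t <= F x -> (forall y, y < x -> F y < t) -> quantile F t = x.
Proof.
move=> tx Flt; have lbx : lbound [set y | t <= F y] x.
  by move=> y /= ty; rewrite leNgt; apply/negP => /Flt; rewrite ltNge ty.
apply/le_anti/andP; split; first by apply: ge_inf => //; exists x.
by apply: lb_le_inf => //; exists x.
Qed.

(** * The two overlap integrals and the image *)

Lemma Rintegral_itv01_cst (R : realType) (k : R) :
  \int[lebesgue_measure]_(_ in `]0, 1[) k = k.
Proof.
by rewrite Rintegral_cst//= lebesgue_measure_itv/= lte_fin ltr01 oppr0 adde0 mulr1.
Qed.

Lemma double_relative_effect (R : realType) (F G : R -> R) :
  CDF F -> CDF G -> 2 * relative_effect F G =
  \int[lebesgue_measure]_(a in `]0, 1[) G (quantile F (a / 2)) +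
  \int[lebesgue_measure]_(a in `]0, 1[) G (quantile F (1 - a / 2)).
Proof.
move=> cF cG; have [g [ndg g01 gE]] := CDF_quantile_extension cF cG.
have -> : relative_effect F G = \int[lebesgue_measure]_(a in `]0, 1[) g a.
  by apply: eq_Rintegral => a; rewrite inE/= in_itv/= => /gE.
rewrite Rintegral_halves//; congr (_ + _);
  apply: eq_Rintegral => a; rewrite inE/= in_itv/= => /andP[? ?];
  by rewrite gE//; apply/andP; split; lra.
Qed.

(** The outer bounds come from values in [0, 1], the middle one from [a / 2 <= 1 - a / 2] on ]0, 1[
    and monotonicity of the extension. *)
Lemma overlap_integrals_bounds (R : realType) (F G : R -> R) :
  CDF F -> CDF G ->
  let low := \int[lebesgue_measure]_(a in `]0, 1[) G (quantile F (a / 2)) in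
  let upp := \int[lebesgue_measure]_(a in `]0, 1[) G (quantile F (1 - a / 2)) in
  [/\ 0 <= low, low <= upp & upp <= 1].
Proof.
move=> cF cG /=; have [g [ndg g01 gE]] := CDF_quantile_extension cF cG.
have -> : \int[lebesgue_measure]_(a in `]0, 1[) G (quantile F (a / 2)) =
    \int[lebesgue_measure]_(a in `]0, 1[) g (a / 2).
  apply: eq_Rintegral => a; rewrite inE/= in_itv/= => /andP[? ?].
  by rewrite gE//; apply/andP; split; lra.
have -> : \int[lebesgue_measure]_(a in `]0, 1[) G (quantile F (1 - a / 2)) =
    \int[lebesgue_measure]_(a in `]0, 1[) g (1 - a / 2).
  apply: eq_Rintegral => a; rewrite inE/= in_itv/= => /andP[? ?].
  by rewrite gE//; apply/andP; split; lra.
have il : (@lebesgue_measure R).-integrable `]0, 1[ (EFin \o (fun a => g (a / 2))).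
  apply: integrable_itv01 => //; apply: nondecreasing_measurable => // x y xy.
  by apply: ndg; lra.
have iu : (@lebesgue_measure R).-integrable `]0, 1[ (EFin \o (fun a => g (1 - a / 2))).
  apply: integrable_itv01 => //; apply: nonincreasing_measurable => // x y xy.
  by apply: ndg; lra.
split.
- by apply: Rintegral_ge0 => x _; have /andP[] := g01 (x / 2).
- apply: le_Rintegral => // x; rewrite /= in_itv/= => /andP[? ?].
  by apply: ndg; lra.
- rewrite -[leRHS](@Rintegral_itv01_cst R); apply: le_Rintegral => //.
    by apply: integrable_itv01 => // x; rewrite lexx ler01.
  by move=> x _; have /andP[] := g01 (1 - x / 2).
Qed.

Theorem theorem3p1 (R : realType) :
  [set (relative_effect FG.1 FG.2, overlap_index FG.1 FG.2)
    | FG in @CDF R `*` @CDF R]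
  = [set xy : R * R | 0 <= xy.1 <= 1 /\
      0 <= xy.2 <= Num.min (2 * xy.1) (2 - 2 * xy.1)].
Proof.
apply/seteqP; split=> [_ [[F G] [/= cF cG] <-]|[x y]] /=.
  have := double_relative_effect cF cG.
  have := overlap_integrals_bounds cF cG.
  rewrite le_min /overlap_index => -[? ? ?] ?.
  split; first by apply/andP; split; lra.
  (* In terms of the two integrals, the bounds [2 * x] and [2 - 2 * x] say that the lower one is at
     least 0 and the upper one at most 1. *)
  by apply/and3P; split; lra.
rewrite le_min => -[/andP[x0 x1] /and3P[y0 yx yx']].
pose step p q (y : R) : R :=
  p * (0 <= y)%R%:R + q * (1 <= y)%R%:R + (1 - p - q) * (2 <= y)%R%:R.
pose F := step 2^-1 2^-1.
(* Solving (L + U) / 2 = x and U - L = y gives L = x - y / 2 and U = x + y / 2. The two bounds on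
   [y] make the masses at 0 and 2 nonnegative. *)
pose G := step (x - y / 2) y.
have cF : CDF F by apply: step_CDF; lra.
have cG : CDF G by apply: step_CDF; lra.
have G0 : G 0 = x - y / 2 by rewrite /G /step lexx ler10 lern0/=; lra.
have G1 : G 1 = x + y / 2.
  by rewrite /G /step ler01 lexx lern1/=; lra.
have low : \int[lebesgue_measure]_(a in `]0, 1[) G (quantile F (a / 2))
    = x - y / 2.
  rewrite -[RHS]Rintegral_itv01_cst; apply: eq_Rintegral => a.
  rewrite inE/= in_itv/= => /andP[a0 a1].
  (* The level [a / 2] is below 1/2, the jump of [F] at 0. *)
  rewrite (@quantile_eq _ _ _ 0)// /F /step; first by rewrite lexx ler10 lern0/=; lra.
  by move=> z z0; rewrite !lt_geF/=; lra.
have upp : \int[lebesgue_measure]_(a in `]0, 1[) G (quantile F (1 - a / 2))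
    = x + y / 2.
  rewrite -[RHS]Rintegral_itv01_cst; apply: eq_Rintegral => a.
  rewrite inE/= in_itv/= => /andP[a0 a1].
  (* The level [1 - a / 2] exceeds 1/2, the largest value of [F] before 1. *)
  rewrite (@quantile_eq _ _ _ 1)// /F /step; first by rewrite lexx ler01 lern1/=; lra.
  move=> z z1; rewrite [1 <= z]lt_geF// [2 <= z]lt_geF/=; last lra.
  by case: (0 <= z) => /=; lra.
exists (F, G) => //=; congr pair; last by rewrite /overlap_index low upp; lra.
have := double_relative_effect cF cG; rewrite low upp; lra.
Qed.
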